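(* Let $L=\bigcup_{k=0}^{m-1}(x_k+\Gamma)$ be a crystallographic point packing generated by the lattice $\Gamma$ in $\mathbb{R}^d$, where $m\in\mathbb{N}$, $x_k\in\mathbb{R}^d$ for $0\le k\le m-1$, $x_0=0$, and $x_k-x_j\notin\Gamma$ whenever $k\neq j$. (i) The set of linear coincidence isometries of $L$ is $\mathrm{OC}(\Gamma)$. (ii) Given $R\in \mathrm{OC}(\Gamma)$, let $\sigma=\{(x_j,x_k): Rx_j-x_k\in\Gamma+R\Gamma\}$ (with $0\le j,k\le m-1$). Then \[\Sigma_L(R)=\frac{m}{|\sigma|}\,\Sigma(R).\] In addition, if for each $(x_j,x_k)\in\sigma$ one writes $Rx_j-x_k=\ell_{j,k}+Rt_{j,k}$ with $\ell_{j,k},t_{j,k}\in\Gamma$, then \[L(R)=\bigcup_{(x_j,x_k)\in\sigma}\big[(x_k+\ell_{j,k})+\Gamma(R)\big]=\bigcup_{(x_j,x_k)\in\sigma}\big[(Rx_j-Rt_{j,k})+\Gamma(R)\big].\]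
   Context: A lattice in $\mathbb{R}^d$ is the $\mathbb{Z}$-span of $d$ linearly independent vectors of $\mathbb{R}^d$. $\mathrm{OC}(\Gamma)$ is the set of all $R\in \mathrm{O}(d)$ such that $\Gamma(R):=\Gamma\cap R\Gamma$ has finite index in both $\Gamma$ and $R\Gamma$; for such $R$, $\Sigma(R):=[\Gamma:\Gamma(R)]$. A crystallographic point packing (multilattice) generated by $\Gamma$ is a finite union $L=\bigcup_{k=0}^{m-1}(x_k+\Gamma)$ with $x_0=0$. A cosublattice of $x_k+\Gamma$ is a subset $x_k+\ell+\Gamma'$ with $\ell\in\Gamma$ and $\Gamma'$ a finite index subgroup of $\Gamma$. An $R\in \mathrm{O}(d)$ is a linear coincidence isometry of $L$ if $L(R):=L\cap RL$ includes a cosublattice of some $x_k+\Gamma$, $0\le k\le m-1$. The coincidence index $\Sigma_L(R)$ is the ratio of the density of points (average number of points per unit volume) of $L$ to the density of points of $L(R)$; it is not necessarily an integer. *)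

(* Defs.v *)
From HB Require Import structures.
From mathcomp Require Import all_boot all_order all_algebra.
From mathcomp Require Import finmap.
From mathcomp Require Import all_classical all_reals all_analysis.

Set Implicit Arguments.
Unset Strict Implicit.
Unset Printing Implicit Defensive.

Import Order.TTheory GRing.Theory Num.Theory.
Import numFieldNormedType.Exports.

Local Open Scope classical_set_scope.
Local Open Scope ring_scope.

Section Defs.
Context {R : realType} {d : nat}.
Implicit Types (G H S C : set 'cV[R]_d) (Q : 'M[R]_d).

Definition is_lattice G : Prop :=
  exists2 b : d.-tuple 'cV[R]_d, free b &
    G = [set v | exists z : 'I_d -> int, v = \sum_(i < d) tnth b i *~ z i].

Definition translate (v : 'cV[R]_d) S : set 'cV[R]_d := [set v + s | s in S].

Definition isom_image Q S : set 'cV[R]_d := [set Q *m s | s in S].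

Definition is_subgroup H G : Prop :=
  [/\ H `<=` G, H 0 & forall u v, H u -> H v -> H (u - v)].

(* The cosets of [H] in [G]; only meant for a subgroup [H] of [G]. *)
Definition cosets G H : set (set 'cV[R]_d) := [set translate g H | g in G].

Definition finite_index G H : Prop := finite_set (cosets G H).

(* [G : H]; the value is 0 when the index is infinite. *)
Definition subgroup_index G H : nat := #|` fset_set (cosets G H)|.

Definition orthogonal_mx : set 'M[R]_d := [set Q | Q^T *m Q = 1%:M].

(* S(R) := S /\ R S, used both for a lattice and for a multilattice. *)
Definition coincidence_set S Q : set 'cV[R]_d := S `&` isom_image Q S.

Definition OC G : set 'M[R]_d :=
  [set Q | [/\ orthogonal_mx Q,
               finite_index G (coincidence_set G Q) &
               finite_index (isom_image Q G) (coincidence_set G Q)]].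

Definition Sigma G Q : nat := subgroup_index G (coincidence_set G Q).

(* The cube [-r, r]^d, of volume (2r)^d. *)
Definition cube (r : R) : set 'cV[R]_d := [set v | forall i, `|v i 0| <= r].

(* [S] has (on average) [a] points per unit volume. The finiteness clause is
   needed because [fset_set] of an infinite set is empty. *)
Definition has_density S (a : R) : Prop :=
  (forall r, finite_set (S `&` cube r)) /\
  (#|` fset_set (S `&` cube r)|%:R / (2 * r) ^+ d @[r --> +oo] --> a).

(* A relation rather than a function, so that it also asserts that the two
   densities exist and that the denominator is nonzero. *)
Definition is_coincidence_index (L : set 'cV[R]_d) Q (s : R) : Prop :=
  exists a b : R, [/\ has_density L a, has_density (coincidence_set L Q) b,
                      b != 0 & s = a / b].

Definition is_cosublattice G (v : 'cV[R]_d) C : Prop :=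
  exists l H, [/\ G l, is_subgroup H G, finite_index G H &
                  C = translate (v + l) H].

Section Packing.
Context {m : nat}.
Variables (G : set 'cV[R]_d) (x : 'I_m -> 'cV[R]_d).

Definition packing : set 'cV[R]_d := \bigcup_(k : 'I_m) translate (x k) G.

Definition coincidence_isometries : set 'M[R]_d :=
  [set Q | orthogonal_mx Q /\
    exists (k : 'I_m) C,
      is_cosublattice G (x k) C /\ C `<=` coincidence_set packing Q].

(* The pair (x_j, x_k) is represented by (j, k); the x_k are pairwise distinct
   as soon as they are pairwise incongruent modulo [G]. *)
Definition sigma Q : {set 'I_m * 'I_m} :=
  [set p | `[< exists u v, [/\ G u, isom_image Q G v &
                              Q *m x p.1 - x p.2 = u + v] >]].

End Packing.
End Defs.

(* Main.v *)
Require Import Defs.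
From HB Require Import structures.
From mathcomp Require Import all_boot all_order all_algebra.
From mathcomp Require Import finmap.
From mathcomp Require Import all_classical all_reals all_analysis.
From mathcomp Require Import ring lra.

Set Implicit Arguments.
Unset Strict Implicit.
Unset Printing Implicit Defensive.

Import Order.TTheory GRing.Theory Num.Theory.
Import numFieldNormedType.Exports.

Local Open Scope classical_set_scope.
Local Open Scope ring_scope.

(** Why the theorem holds.

    The set-theoretic part is a computation with cosets.  A point of
    L /\ Q L is at once x_k + g and Q (x_j + h) with g, h in Gamma, so
    Q x_j - x_k lies in Gamma + Q Gamma; conversely each pair (j, k) of sigma
    contributes exactly one coset of Gamma(Q) = Gamma /\ Q Gamma
    ([coincidence_set_packing]).  Distinct pairs give disjoint cosets, because
    the x_k are pairwise incongruent modulo Gamma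
    ([packing_translates_disjoint]).

    For the index, everything reduces to densities.  Density is additive on
    finite disjoint unions and invariant under translation, since moving a set
    by v changes its count in the cube of radius r at most to the counts in
    the cubes of radius r - |v| and r + |v|.  Hence L has density m a and
    L(Q) has density |sigma| b, where a and b are the densities of Gamma and
    Gamma(Q).  The same squeezing, applied to the decomposition of Gamma into
    Sigma(Q) cosets of Gamma(Q), gives b = a / Sigma(Q)
    ([finite_index_has_density]) and even shows that b exists.

    What remains is that a lattice has a positive density
    ([lattice_has_density]), whose value cancels in the ratio.  This is a
    Fekete argument.  A cube of radius r' contains n^d non-overlapping cubes of
    radius r as soon as n r <= r'.  Each of these contains a cube of radius
    r - c centred at a lattice point, and so at least N(r - c) lattice points,
    where N counts those in the centred cube.  Hence N is supermultiplicative
    up to a bounded loss c in the radius ([cube_count_tile]), and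
    N(r) / (2r)^d converges to the supremum of N(r - c) / (2r)^d
    ([cvg_density_supermultiplicative]).

    For the equality of the two sets of isometries, let x_k + l + H lie in
    L /\ Q L with H of finite index in Gamma.  Each h in H lands in one of the
    m cosets Q x_j + Q Gamma; subtracting a fixed element of H that lands in
    the same coset puts it in Gamma(Q).  Thus every vector lies within bounded
    distance of Gamma(Q)
    ([coincidence_isometry_relatively_dense]), and a relatively dense subgroup
    of a locally finite group has finite index.  This criterion applies to
    Gamma and to Q Gamma alike, and so gives both indices at once. *)

(** * Limits of counts per volume *)

Section Growth.
Context {R : realType}.
Implicit Types (c r a : R) (N : R -> R).

Lemma cvg_shift_ratioX d c : ((r + c) / r) ^+ d @[r --> +oo] --> (1 : R).
Proof.
have V0 : (r^-1 : R) @[r --> +oo] --> (0 : R).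
  by apply/gtr0_cvgV0 => //; apply: nbhs_pinfty_gt; exact: num_real.
have -> : (1 : R) = (1 + c * 0) ^+ d by rewrite mulr0 addr0 expr1n.
apply: (@cvg_trans _ ((1 + c * r^-1) ^+ d @[r --> +oo])).
  apply: near_eq_cvg; near=> r.
  have r0 : r != 0 by apply: lt0r_neq0; near: r; apply: nbhs_pinfty_gt; exact: num_real.
  by rewrite mulrDl divff.
apply: (@cvg_comp _ _ _ (fun r => 1 + c * r^-1) (fun y => y ^+ d)).
  exact: cvgD (cvg_cst _) (cvgM (cvg_cst _) V0).
exact: exprn_continuous.
Unshelve. all: by end_near. Qed.

(** Boundary effects are invisible to the density: enlarging or shrinking the
    radius by a constant multiplies the count per volume by a factor that
    tends to 1. *)
Lemma cvg_density_shift d N a c :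
  N r / (2 * r) ^+ d @[r --> +oo] --> a ->
  N (r + c) / (2 * r) ^+ d @[r --> +oo] --> a.
Proof.
rewrite -(cvg_shiftr c) => Na.
rewrite -[a]mulr1; apply: cvg_trans (cvgM Na (@cvg_shift_ratioX d c)).
apply: near_eq_cvg; near=> r.
have r0 : r != 0 by apply: lt0r_neq0; near: r; apply: nbhs_pinfty_gt; exact: num_real.
have rc0 : r + c != 0.
  by rewrite -[c]opprK subr_eq0 gt_eqF//; near: r; apply: nbhs_pinfty_gt; exact: num_real.
rewrite /= -!mulrA; congr (_ * _).
rewrite -!exprVn -exprMn; congr (_ ^+ d).
by field; rewrite r0 rc0.
Unshelve. all: by end_near. Qed.

(** A form of Fekete's lemma.  The limit is the supremum [a] of
    [N (r - c) / (2 * r) ^+ d].  Taking [r + c] for [r] bounds the density from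
    above by [a] up to a factor tending to 1; tiling with a fixed nearly
    optimal radius bounds it from below. *)
Lemma cvg_density_supermultiplicative d N c K :
  0 < c ->
  (forall r, 0 < r -> 1 <= N r <= (K * (2 * (r + c))) ^+ d) ->
  (forall n r r', c < r -> n%:R * r <= r' -> n%:R ^+ d * N (r - c) <= N r') ->
  exists2 a : R, 0 < a & N r / (2 * r) ^+ d @[r --> +oo] --> a.
Proof.
move=> c0 bN tileN.
pose E : set R := (fun r => N (r - c) / (2 * r) ^+ d) @` [set r | c < r].
have pow_gt0 s : 0 < s -> 0 < (2 * s) ^+ d by move=> s0; rewrite exprn_gt0 ?mulr_gt0.
have supE : has_sup E.
  split; first by exists (N (2 * c - c) / (2 * (2 * c)) ^+ d), (2 * c) => //=; lra.
  exists (K ^+ d) => _ [r /= cr <-].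
  rewrite ler_pdivrMr; last by apply: pow_gt0; lra.
  rewrite -exprMn.
  have /andP[_] := bN (r - c) ltac:(lra).
  by rewrite subrK.
pose a := sup E.
have Ea s : c < s -> N (s - c) / (2 * s) ^+ d <= a.
  by move=> cr; apply: ub_le_sup; [case: supE | exists s].
exists a.
  apply: lt_le_trans (Ea (2 * c) ltac:(lra)).
  apply: divr_gt0; last by apply: pow_gt0; lra.
  by have /andP[+ _] := bN (2 * c - c) ltac:(lra); apply: lt_le_trans.
apply/cvgrPdist_le => e e0.
(* [r0] is the nearly optimal radius of the tiles. *)
have [_ [r0 /= cr0 <-]] := sup_adherent e0 supE.
rewrite -/a; set s := N _ / _ => s_gt.
have up : a * ((r + c) / r) ^+ d @[r --> +oo] --> a * 1.
  exact: cvgM (cvg_cst _) (@cvg_shift_ratioX d c).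
have lo : s * ((r - r0) / r) ^+ d @[r --> +oo] --> s * 1.
  exact: cvgM (cvg_cst _) (@cvg_shift_ratioX d (- r0)).
near=> r.
have r_gt0 : 0 < r by near: r; apply: nbhs_pinfty_gt; exact: num_real.
have r_ge : r0 <= r by near: r; apply: nbhs_pinfty_ge; exact: num_real.
have r0_gt0 : 0 < r0 by lra.
rewrite ler_distlC; apply/andP; split.
- apply: (@le_trans _ _ (s * ((r - r0) / r) ^+ d)).
    apply: ltW; near: r; apply: (cvgr_gt (s * 1)) lo _ _; rewrite mulr1; exact: s_gt.
  pose n := Num.trunc (r / r0).
  have rr0 : 0 <= r / r0 by apply: divr_ge0; lra.
  have n_le : n%:R * r0 <= r by rewrite -ler_pdivlMr// truncn_le.
  have n_gt : r - r0 <= n%:R * r0.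
    have := truncnS_gt (r / r0); rewrite ltr_pdivrMr// -/n -natr1; lra.
  rewrite ler_pdivlMr ?pow_gt0//.
  apply: le_trans (tileN _ _ _ cr0 n_le).
  have -> : s * ((r - r0) / r) ^+ d * (2 * r) ^+ d =
            N (r0 - c) * ((r - r0) / r0) ^+ d.
    rewrite /s -!mulrA; congr (_ * _); rewrite -!exprVn -!exprMn.
    by congr (_ ^+ d); field; rewrite !gt_eqF.
  rewrite mulrC ler_wpM2r//.
    have /andP[+ _] := bN (r0 - c) ltac:(lra); lra.
  apply: lerXn2r; rewrite ?nnegrE ?ler0n//; first by apply: divr_ge0; lra.
  by rewrite ler_pdivrMr.
- apply: (@le_trans _ _ (a * ((r + c) / r) ^+ d)); last first.
    by apply: ltW; near: r; apply: (cvgr_lt (a * 1)) up _ _; rewrite mulr1; lra.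
  rewrite ler_pdivrMr ?pow_gt0//.
  have := Ea (r + c) ltac:(lra).
  rewrite addrK ler_pdivrMr; last by apply: pow_gt0; lra.
  move=> /le_trans; apply; rewrite -mulrA -exprMn.
  suff -> : (r + c) / r * (2 * r) = 2 * (r + c) by [].
  by field; rewrite gt_eqF.
Unshelve. all: by end_near. Qed.

End Growth.

(** * Counting points in cubes *)

Section Counting.

Lemma card_fset_set_inj (T U : choiceType) (A : set T) (B : set U) (f : T -> U) :
  finite_set B -> (forall a, A a -> B (f a)) -> {in A &, injective f} ->
  finite_set A /\ (#|` fset_set A| <= #|` fset_set B|)%N.
Proof.
move=> finB fAB injf; have eqA := inj_card_eq injf.
have subB : f @` A `<=` B by move=> _ [a Aa <-]; exact: fAB.
have finfA := sub_finite_set subB finB.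
have finA : finite_set A by rewrite -(eq_finite_set eqA).
split=> //; move/(fcard_eq finfA finA): eqA => <-.
by apply: fsubset_leq_card; rewrite -fset_set_sub.
Qed.

Lemma card_fset_set_uniq (T : choiceType) (A : set T) (s : seq T) :
  uniq s -> A = [set` s] -> #|` fset_set A| = size s.
Proof.
move=> us ->; apply: perm_size; apply: uniq_perm; rewrite ?fset_uniq// => x.
rewrite in_fset_set; last exact: finite_seq.
by apply/idP/idP => [/set_mem//|xs]; exact: mem_set.
Qed.

Lemma card_fset_setT (T : finType) : #|` fset_set [set: T]| = #|T|.
Proof.
rewrite cardT; apply: card_fset_set_uniq (enum_uniq _) _.
by apply/seteqP; split=> x //= _; rewrite mem_enum.
Qed.

Lemma card_fset_setX (T U : choiceType) (A : set T) (B : set U) :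
  finite_set A -> finite_set B ->
  #|` fset_set (A `*` B)| = (#|` fset_set A| * #|` fset_set B|)%N.
Proof.
move=> finA finB; rewrite -(size_allpairs pair); apply: card_fset_set_uniq.
  by apply: allpairs_uniq => [||[? ?] [? ?] _ _ //]; exact: fset_uniq.
apply/seteqP; split=> [[x y] [/= Ax By]|_ /allpairsP[p [/= + + ->]]] /=.
  by apply/allpairsP; exists (x, y); rewrite !in_fset_set// !inE.
by rewrite !in_fset_set// !inE.
Qed.

Context {R : realType} {d : nat}.
Implicit Types (S T : set 'cV[R]_d) (v w : 'cV[R]_d) (r c a : R).

Lemma cubeN r v : cube r v -> cube r (- v).
Proof. by move=> rv i; rewrite mxE normrN. Qed.

Lemma cubeD r c v w : cube r v -> cube c w -> cube (r + c) (v + w).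
Proof. by move=> rv cw i; rewrite mxE (le_trans (ler_normD _ _))// lerD. Qed.

Lemma cubeB r c v w : cube r v -> cube c w -> cube (r + c) (v - w).
Proof. by move=> rv cw; apply: cubeD => //; exact: cubeN. Qed.

Lemma cube_le r c v : r <= c -> cube r v -> cube c v.
Proof. by move=> rc rv i; exact: le_trans rc. Qed.

(** A sum rather than a maximum of the absolute values of the entries: all that
    matters is that it bounds each of them. *)
Definition radius v : R := \sum_i `|v i 0|.

Lemma radius_ge0 v : 0 <= radius v.
Proof. exact: sumr_ge0. Qed.

Lemma cube_radius v : cube (radius v) v.
Proof.
by move=> i; rewrite /radius (bigD1 i)//= lerDl sumr_ge0.
Qed.

Lemma translateP v S w : translate v S w <-> S (w - v).
Proof.
split=> [[s Ss <-]|Swv]; first by rewrite addrC addKr.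
by exists (w - v) => //; rewrite addrC subrK.
Qed.

Definition locally_finite S := forall r, finite_set (S `&` cube r).

Definition cube_count S r : nat := #|` fset_set (S `&` cube r)|.

Lemma sub_locally_finite S T : S `<=` T -> locally_finite T -> locally_finite S.
Proof. by move=> ST finT r; apply: sub_finite_set (finT r); exact: setSI. Qed.

(** Undoing the translation carries the cube of radius [r] into the cube of
    radius [r + c]. *)
Lemma cube_count_translate S v c r :
  locally_finite S -> cube c v ->
  finite_set (translate v S `&` cube r) /\
  (cube_count (translate v S) r <= cube_count S (r + c))%N.
Proof.
move=> finS cv; apply: (card_fset_set_inj (f := fun w => w - v)) => //.
  by move=> w [/translateP Swv rw]; split=> //; exact: cubeB.
by move=> w w' _ _; exact: addIr.
Qed.

Lemma locally_finite_translate S v : locally_finite S -> locally_finite (translate v S).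
Proof. by move=> finS r; case: (cube_count_translate r finS (cube_radius v)). Qed.

Lemma translateK S v : translate (- v) (translate v S) = S.
Proof.
apply/seteqP; split=> w.
  by move=> /translateP/translateP; rewrite opprK addrK.
by move=> Sw; apply/translateP/translateP; rewrite opprK addrK.
Qed.

Lemma cube_count_translate_ge S v c r :
  locally_finite S -> cube c v ->
  (cube_count S r <= cube_count (translate v S) (r + c))%N.
Proof.
move=> finS cv; rewrite -{1}(translateK S v).
apply: (cube_count_translate r _ (cubeN cv)).2.
exact: locally_finite_translate.
Qed.

Lemma cube_countU S T r : locally_finite S -> locally_finite T ->
  S `&` T = set0 -> cube_count (S `|` T) r = (cube_count S r + cube_count T r)%N.
Proof.
move=> finS finT ST0; rewrite /cube_count setIUl fset_setU//.
rewrite cardfsU -fset_setI// setIACA ST0 set0I fset_set0.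
by rewrite cardfs0 subn0.
Qed.

Lemma locally_finiteU S T :
  locally_finite S -> locally_finite T -> locally_finite (S `|` T).
Proof. by move=> finS finT r; rewrite setIUl finite_setU. Qed.

Lemma cube_count0 r : cube_count set0 r = 0%N.
Proof. by rewrite /cube_count set0I fset_set0 cardfs0. Qed.

Lemma cube_count_bigsetU (I : choiceType) (s : seq I) (F : I -> set 'cV[R]_d) :
  uniq s -> (forall i, i \in s -> locally_finite (F i)) ->
  {in s &, forall i j v, F i v -> F j v -> i = j} ->
  locally_finite (\big[setU/set0]_(i <- s) F i) /\
  forall r, cube_count (\big[setU/set0]_(i <- s) F i) r =
            (\sum_(i <- s) cube_count (F i) r)%N.
Proof.
elim: s => [_ _ _|i s IHs /= /andP[i_s us] finF dis].
  by rewrite big_nil; split=> [r|r]; rewrite ?big_nil ?cube_count0// set0I.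
have [finU countU] : _ /\ _ := IHs us (fun j sj => finF j (mem_behead (s := i :: s) sj))
  (sub_in2 (mem_behead (s := i :: s)) dis).
have finFi : locally_finite (F i) by apply: finF; rewrite inE eqxx.
rewrite big_cons; split=> [|r]; first exact: locally_finiteU.
rewrite cube_countU// ?countU ?big_cons//.
rewrite -subset0 => v [Fiv]; rewrite -bigcup_seq => -[j /= js Fjv].
suff ij : i = j by rewrite ij js in i_s.
by apply: (dis _ _ _ _ v) => //; rewrite inE ?eqxx ?js ?orbT.
Qed.

(** The common source of translation invariance ([k = 1]) and of the index
    formula for subgroups ([k] cosets with the same count up to boundary
    effects). *)
Lemma has_density_squeeze S T c k a : has_density S a -> locally_finite T ->
  (0 < k)%N ->
  (forall r, cube_count S (r - c) <= k * cube_count T r <= cube_count S (r + c))%N ->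
  has_density T (a / k%:R).
Proof.
move=> [finS densS] finT k0 ST; split=> //.
have lim c' : (cube_count S (r + c'))%:R / (2 * r) ^+ d / k%:R @[r --> +oo] -->
    a / k%:R.
  apply: cvgM (cvg_cst _).
  exact: (@cvg_density_shift _ d (fun r => (cube_count S r)%:R)).
apply: squeeze_cvgr (lim (- c)) (lim c); near=> r.
have r0 : 0 < r by near: r; apply: nbhs_pinfty_gt; exact: num_real.
have k_gt0 : 0 < k%:R :> R by rewrite ltr0n.
have vol : 0 <= ((2 * r) ^+ d)^-1 by rewrite invr_ge0 exprn_ge0// mulr_ge0// ltW.
set V := (_ ^+ d)^-1 in vol *; have /andP[lo up] := ST r.
have -> : (cube_count T r)%:R * V = (k * cube_count T r)%:R * V / k%:R.
  by rewrite natrM mulrAC [k%:R * _]mulrC mulfK ?gt_eqF.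
have le_div p q : (p <= q)%N -> p%:R * V / k%:R <= q%:R * V / k%:R.
  by move=> pq; rewrite ler_pM2r ?invr_gt0// ler_wpM2r// ler_nat.
by rewrite !le_div.
Unshelve. all: by end_near. Qed.

Lemma has_density_translate S v a : has_density S a -> has_density (translate v S) a.
Proof.
move=> densS; have finS : locally_finite S := densS.1.
rewrite -[a]divr1; apply: (has_density_squeeze (c := radius v) (k := 1) densS) => //.
  exact: locally_finite_translate.
move=> r; rewrite mul1n.
rewrite (cube_count_translate _ _ (cube_radius v)).2// andbT.
by rewrite -{2}[r](subrK (radius v)) cube_count_translate_ge//; exact: cube_radius.
Qed.

Lemma has_density_bigcup (I : finType) (D : {set I}) (F : I -> set 'cV[R]_d) a :
  (forall i, i \in D -> has_density (F i) a) ->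
  {in D &, forall i j v, F i v -> F j v -> i = j} ->
  has_density (\bigcup_(i in [set` D]) F i) (#|D|%:R * a).
Proof.
move=> densF dis.
have -> : \bigcup_(i in [set` D]) F i = \big[setU/set0]_(i <- enum D) F i.
  by rewrite -bigcup_seq; apply: eq_bigcupl; split=> i /=; rewrite mem_enum.
have [||finU countU] := @cube_count_bigsetU _ (enum D) F (enum_uniq _).
- by move=> i; rewrite mem_enum => /densF[].
- by move=> i j; rewrite !mem_enum; exact: dis.
split=> //.
have -> : #|D|%:R * a = \sum_(i in D) a by rewrite sumr_const mulr_natl.
have lim : \sum_(i in D) ((cube_count (F i) r)%:R / (2 * r) ^+ d) @[r --> +oo] -->
    \sum_(i in D) a.
  apply: (@cvg_big R I +%R 0 (mem D) (@add_continuous R) R +oo%R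
    (index_enum I) (fun i r => (cube_count (F i) r)%:R / (2 * r) ^+ d) (fun=> a)).
  by move=> i /densF[].
apply: cvg_trans lim; apply: near_eq_cvg; near=> r.
by rewrite -mulr_suml -natr_sum -big_enum -countU.
Unshelve. all: by end_near. Qed.

End Counting.

(** * Relatively dense subgroups and finite index *)

Section RelativelyDense.
Context {R : realType} {d : nat}.
Implicit Types (G H S T : set 'cV[R]_d) (v w g : 'cV[R]_d) (r c a : R).

Definition relatively_dense S c := forall w, exists2 s, S s & cube c (w - s).

Lemma subgroupN H G v : is_subgroup H G -> H v -> H (- v).
Proof. by case=> _ H0 HB Hv; rewrite -[- v]sub0r; exact: HB. Qed.

Lemma subgroupD H G v w : is_subgroup H G -> H v -> H w -> H (v + w).
Proof.
move=> HG Hv Hw; rewrite -[w]opprK; have [_ _ HB] := HG.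
by apply: HB => //; exact: subgroupN HG Hw.
Qed.

Lemma translate_subgroupP H G v w : is_subgroup H G ->
  translate v H = translate w H <-> H (v - w).
Proof.
move=> HG; have [_ H0 HB] := HG; split=> [eq_vw|Hvw].
  by apply/translateP; rewrite -eq_vw; apply/translateP; rewrite subrr.
apply/seteqP; split=> u /translateP Hu; apply/translateP.
  by have := subgroupD HG Hu Hvw; rewrite addrA subrK.
by have := HB _ _ Hu Hvw; rewrite opprB addrA subrK.
Qed.

(** There are finitely many cosets, hence representatives of bounded size: this
    turns statements about the index into statements about distances. *)
Lemma finite_index_bounded_reprs G H : is_subgroup H G -> finite_index G H ->
  exists2 c, 0 <= c &
    forall C, cosets G H C -> exists2 g, cube c g & C = translate g H.
Proof.
move=> HG fin.
have /choice[rep repP] : forall C, exists g, cosets G H C -> C = translate g H.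
  move=> C; case: (pselect (cosets G H C)) => [[g Gg <-]|notC]; last by exists 0.
  by exists g.
exists (\sum_(C <- fset_set (cosets G H)) radius (rep C)).
  by apply: sumr_ge0 => C _; exact: radius_ge0.
move=> C HC; exists (rep C); last exact: repP.
apply: cube_le (cube_radius _).
rewrite (bigD1_seq C) ?fset_uniq//=; last by rewrite in_fset_set// inE.
by rewrite lerDl; apply: sumr_ge0 => ? _; exact: radius_ge0.
Qed.

Lemma finite_index_relatively_dense G H c : is_subgroup H G -> finite_index G H ->
  relatively_dense G c -> exists c', relatively_dense H c'.
Proof.
move=> HG fin denseG; have [c1 _ reps] := finite_index_bounded_reprs HG fin.
exists (c + c1) => w; have [g Gg wg] := denseG w.
have [g1 g1c /(translate_subgroupP _ _ HG) Hgg1] := reps _ (ex_intro2 _ _ g Gg erefl).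
by exists (g - g1) => //; rewrite opprB addrCA addrC; exact: cubeD.
Qed.

(** Every coset has a representative at bounded distance from 0, of which [G]
    has only finitely many. *)
Lemma relatively_dense_finite_index G H c : is_subgroup H G -> locally_finite G ->
  (forall u v, G u -> G v -> G (u - v)) ->
  relatively_dense H c -> finite_index G H.
Proof.
move=> HG finG GB denseH.
apply: sub_finite_set (finite_image (fun g => translate g H) (finG c)).
move=> _ [g Gg <-]; have [h Hh gh] := denseH g.
exists (g - h); first by split=> //; apply: GB => //; case: HG => + _ _; apply.
by apply/(translate_subgroupP _ _ HG); rewrite addrAC subrr sub0r; exact: subgroupN HG Hh.
Qed.

Lemma subgroup_index_gt0 G H : G 0 -> finite_index G H -> (0 < subgroup_index G H)%N.
Proof.
move=> G0 fin; rewrite cardfs_gt0; apply/fset0Pn; exists (translate 0 H).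
by rewrite in_fset_set// inE; exists 0.
Qed.

(** The cosets of [H] partition [G], and their counts agree with that of [H] up
    to a bounded change of the radius. *)
Lemma finite_index_has_density G H a : is_subgroup H G -> G 0 ->
  (forall u v, G u -> G v -> G (u + v)) -> finite_index G H ->
  has_density G a -> has_density H (a / (subgroup_index G H)%:R).
Proof.
move=> HG G0 GD fin densG; have [HsubG H0 HB] := HG.
have finG : locally_finite G := densG.1.
have finH : locally_finite H by exact: sub_locally_finite finG.
have [c _ reps] := finite_index_bounded_reprs HG fin.
pose s := fset_set (cosets G H).
have sP C : C \in s -> exists2 g, cube c g & C = translate g H.
  by rewrite in_fset_set// inE => /reps.
have [||_ countU] := @cube_count_bigsetU R d _ s id (fset_uniq s).
- by move=> C /sP[g _ ->]; exact: locally_finite_translate.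
- move=> _ _ /sP[g _ ->] /sP[g' _ ->] v /translateP Hv /translateP Hv'.
  apply/(translate_subgroupP _ _ HG); have := HB _ _ Hv' Hv.
  by rewrite opprB addrC addrA subrK.
have unionG : \big[setU/set0]_(C <- s) C = G.
  rewrite bigsetU_fset_set//; apply/seteqP; split=> [v [_ [g Gg <-]]|v Gv].
    by case=> h /HsubG Gh <-; exact: GD.
  by exists (translate v H); [exists v | apply/translateP; rewrite subrr].
rewrite unionG in countU.
have count_const n : \sum_(C <- s) n = (subgroup_index G H * n)%N.
  by rewrite big_const_seq count_predT iter_addn_0 mulnC.
apply: (has_density_squeeze (c := c) densG) => //; first exact: subgroup_index_gt0.
move=> r; rewrite !countU -count_const !big_seq; apply/andP; split.
  apply: leq_sum => C /sP[g cg ->].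
  by rewrite -{2}[r](subrK c) (cube_count_translate _ finH cg).2.
apply: leq_sum => C /sP[g cg ->].
exact: cube_count_translate_ge.
Qed.

End RelativelyDense.

(** * Lattices *)

Section Lattices.
Context {R : realType} {d : nat}.
Implicit Types (G H S T : set 'cV[R]_d) (v w g : 'cV[R]_d) (r c a : R).

Lemma cube_mulmx (A : 'M[R]_d) :
  exists2 K : R, 0 <= K & forall r v, cube r v -> cube (K * r) (A *m v).
Proof.
exists (\sum_i \sum_j `|A i j|); first by do 2![apply: sumr_ge0 => ? _].
move=> r v rv i; have r0 : 0 <= r by apply: le_trans (rv i).
rewrite mxE [X in _ <= X * _](bigD1 i)//= mulrDl -[X in X <= _]addr0.
apply: lerD; last by rewrite mulr_ge0//; do 2![apply: sumr_ge0 => ? _].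
rewrite mulr_suml; apply: le_trans (ler_norm_sum _ _ _) _.
by apply: ler_sum => j _; rewrite normrM ler_wpM2l.
Qed.

(** Place [n ^ d] cubes of radius [r] side by side in the cube of radius [r'],
    move each centre to a lattice point at distance at most [c0], and shrink
    the radius to [r - c]: each small cube then contains a translate of the
    lattice points of the centred cube of radius [r - c], and the strict
    inequality [c0 < c] keeps the small cubes disjoint even though the original
    ones share their faces. *)
Lemma cube_count_tile G c0 c n r r' :
  locally_finite G -> (forall u v, G u -> G v -> G (u + v)) ->
  relatively_dense G c0 -> 0 < c -> c0 < c -> c < r -> n%:R * r <= r' ->
  (n ^ d * cube_count G (r - c) <= cube_count G r')%N.
Proof.
move=> finG GD denseG c_gt0 c0c cr nr.
have /choice[near_pt near_ptP] : forall w, exists g, G g /\ cube c0 (w - g).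
  by move=> w; have [g] := denseG w; exists g.
pose centre (k : {ffun 'I_d -> 'I_n}) : 'cV[R]_d :=
  \col_i (- r' + r * (2 * (k i)%:R + 1)).
pose A := [set: {ffun 'I_d -> 'I_n}] `*` (G `&` cube (r - c)).
have finA : finite_set A by apply: finite_setX => //; exact: finite_finset.
have <- : #|` fset_set A| = (n ^ d * cube_count G (r - c))%N.
  rewrite card_fset_setX//; last exact: finite_finset.
  by rewrite card_fset_setT card_ffun !card_ord.
apply: (card_fset_set_inj (f := fun p => near_pt (centre p.1) + p.2) (finG r') _ _).2.
  move=> [k h] [_ [/= Gh hr]]; have [Gg gc] := near_ptP (centre k).
  split; first exact: GD.
  have centre_r : cube (r' - r) (centre k).
    move=> i; rewrite mxE ler_norml.
    have k_lo : 0 <= r * (k i)%:R by rewrite mulr_ge0//; lra.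
    have k_hi : r * (k i)%:R + r <= r'.
      have : (k i).+1%:R * r <= n%:R * r by rewrite ler_wpM2r ?ler_nat//; lra.
      by rewrite -natr1; lra.
    apply/andP; split; lra.
  have -> : near_pt (centre k) + h = centre k - (centre k - near_pt (centre k)) + h.
    by rewrite subKr.
  apply: cube_le (cubeD (cubeB centre_r gc) hr); lra.
move=> [k h] [k' h'] /set_mem[_ [/= Gh hr]] /set_mem[_ [/= Gh' hr']] eq_pt.
have [[_ gc] [_ gc']] := (near_ptP (centre k), near_ptP (centre k')).
suff kk' : k = k' by move: eq_pt; rewrite kk' => /addrI ->.
apply/ffunP => i; apply/eqP/negPn/negP => neq_ki.
(* Two equal images force the centres to be closer than [2 * r], whereas
   distinct centres differ by at least [2 * r] in some coordinate. *)
have := cubeD (cubeB gc gc') (cubeB hr' hr).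
have -> : centre k - near_pt (centre k) - (centre k' - near_pt (centre k')) + (h' - h)
    = centre k - centre k'.
  rewrite -[h'](addKr (near_pt (centre k'))) -eq_pt.
  by rewrite !opprD !opprK; apply/colP => j; rewrite !mxE; ring.
move=> /(_ i); rewrite !mxE.
have -> : - r' + r * (2 * (k i)%:R + 1) - (- r' + r * (2 * (k' i)%:R + 1)) =
    2 * r * ((k i)%:R - (k' i)%:R) by ring.
rewrite normrM gtr0_norm; last by lra.
have : 1 <= `|(k i)%:R - (k' i)%:R : R|.
  rewrite -[(k i)%:R]/((k i)%:Z%:~R) -[(k' i)%:R]/((k' i)%:Z%:~R) -rmorphB /=.
  by rewrite -intr_norm (ler_int _ 1) -gtz0_ge1 normr_gt0 subr_eq0 eqz_nat.
rewrite -(ler_pM2l (x := 2 * r)); last by lra.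
lra.
Qed.

Lemma lattice_subgroup G : is_lattice G ->
  [/\ G 0, forall u v, G u -> G v -> G (u + v) & forall u v, G u -> G v -> G (u - v)].
Proof.
case=> b _ ->; split.
- by exists (fun=> 0); rewrite big1.
- move=> _ _ [z ->] [z' ->]; exists (fun i => z i + z' i).
  by rewrite -big_split; apply: eq_bigr => i _; rewrite mulrzDr.
- move=> _ _ [z ->] [z' ->]; exists (fun i => z i - z' i).
  by rewrite -sumrB; apply: eq_bigr => i _; rewrite mulrzBr.
Qed.

(** [A] is the matrix of the coordinate map in the basis [b].  Having the
    coordinates as a matrix product lets [cube_mulmx] bound them. *)
Lemma free_coordinates (b : d.-tuple 'cV[R]_d) : free b ->
  exists A : 'M[R]_d,
    (forall v, v = \sum_i (A *m v) i 0 *: tnth b i) /\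
    (forall z : 'I_d -> int, forall i, (A *m (\sum_j tnth b j *~ z j)) i 0 = (z i)%:~R).
Proof.
move=> free_b.
have basis_b : basis_of fullv b.
  by rewrite basisEfree free_b subvf dimvf dim_matrix mulr1 size_tuple leqnn.
exists (\matrix_(i, j) coord b i (delta_mx j 0)).
have AE v i : ((\matrix_(i, j) coord b i (delta_mx j 0)) *m v) i 0 = coord b i v.
  rewrite {2}[v]matrix_sum_delta linear_sum mxE; apply: eq_bigr => j _ /=.
  by rewrite big_ord1 linearZ !mxE mulrC.
split=> [v|z i].
  rewrite {1}(coord_basis basis_b (memvf v)); apply: eq_bigr => i _.
  by rewrite AE (tnth_nth 0).
rewrite AE.
have -> : \sum_j tnth b j *~ z j = \sum_j (z j)%:~R *: b`_j.
  by apply: eq_bigr => j _; rewrite -(tnth_nth 0) scaler_int.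
by rewrite coord_sum_free.
Qed.

(** Round the coordinates down. *)
Lemma lattice_relatively_dense G : is_lattice G ->
  exists2 c, 0 <= c & relatively_dense G c.
Proof.
case=> b /free_coordinates[A [AK _]] ->.
exists (\sum_i radius (tnth b i)); first by apply: sumr_ge0 => ? _; exact: radius_ge0.
move=> w; exists (\sum_i tnth b i *~ Num.floor ((A *m w) i 0)).
  by exists (fun i => Num.floor ((A *m w) i 0)).
rewrite {1}[w]AK -sumrB => k; rewrite summxE; apply: le_trans (ler_norm_sum _ _ _) _.
apply: ler_sum => i _; rewrite -scaler_int -scalerBl mxE normrM.
apply: le_trans (cube_radius (tnth b i) k); rewrite ler_piMl//.
have /andP[lo hi] := floor_itv ((A *m w) i 0).
by rewrite ger0_norm ?subr_ge0// lerBlDl; move: hi; rewrite intrD => /ltW.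
Qed.

(** The coordinates of a lattice point in a cube are integers bounded linearly
    in the radius. *)
Lemma lattice_cube_count G : is_lattice G ->
  exists2 K, 0 <= K & forall r, 0 <= r ->
    finite_set (G `&` cube r) /\ (cube_count G r)%:R <= (2 * (K * r) + 1) ^+ d.
Proof.
case=> b /free_coordinates[A [AK Aint]] ->.
have [K K0 AKr] := cube_mulmx A; exists K => // r r0.
set G' := [set _ | _].
pose n := Num.trunc (K * r); have Kr0 : 0 <= K * r by exact: mulr_ge0.
have n_le : n%:R <= K * r by rewrite truncn_le.
(* The shift by [n] makes the coordinates, which lie in [-n, n], natural. *)
pose f v : {ffun 'I_d -> 'I_(n.*2.+1)} :=
  [ffun i => inord (absz (Num.floor ((A *m v) i 0) + n%:Z))].
have fE v i : (G' `&` cube r) v -> 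
    exists2 z : int, (A *m v) i 0 = z%:~R & f v i = z + n%:Z :> int.
  move=> [[z zv] /AKr/(_ i)]; rewrite ffunE zv Aint => zK.
  exists (z i) => //; rewrite intrKfloor.
  have : `|z i| <= n%:Z.
    have [k zk] : exists k : nat, `|z i| = k%:Z by exists `|z i|%N; rewrite abszE.
    rewrite zk lez_nat truncn_ge_nat// (le_trans _ zK)// -intr_norm zk //.
  rewrite ler_norml => /andP[lo hi].
  have z_ge0 : 0 <= z i + n%:Z by rewrite -lerBlDr sub0r.
  rewrite inordK ?gez0_abs// ltnS -lez_nat gez0_abs// -addnn PoszD lerD2r//.
have [||finG leG] := @card_fset_set_inj _ _ (G' `&` cube r)
   [set: {ffun 'I_d -> 'I_(n.*2.+1)}] f finite_finset.
- by [].
- move=> v w /set_mem Gv /set_mem Gw eq_f; rewrite [v]AK [w]AK; apply: eq_bigr => i _.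
  have [z -> fv] := fE v i Gv; have [z' -> fw] := fE w i Gw.
  by congr (_%:~R *: _); apply: (addIr n%:Z); rewrite -fv -fw eq_f.
split=> //; move: leG; rewrite card_fset_setT card_ffun !card_ord -(ler_nat R).
move=> /le_trans; apply; rewrite natrX lerXn2r ?nnegrE ?ler0n//; first lra.
by rewrite -natr1 -muln2 natrM; lra.
Qed.

Lemma lattice_locally_finite G : is_lattice G -> locally_finite G.
Proof.
case/lattice_cube_count=> K _ count r.
have [r0|r0] := leP 0 r; first by case: (count r r0).
case: (count 0 (lexx 0)) => fin0 _; apply: sub_finite_set fin0 => v [Gv rv].
by split=> //; apply: cube_le rv; exact: ltW.
Qed.

Lemma lattice_has_density G : is_lattice G -> exists2 a, 0 < a & has_density G a.
Proof.
move=> latG; have [G0 GD _] := lattice_subgroup latG.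
have [c0 c0_ge0 denseG] := lattice_relatively_dense latG.
have finG := lattice_locally_finite latG.
have [K K0 countG] := lattice_cube_count latG.
have [|r r0|n r r' cr nr|a a0 densG] := @cvg_density_supermultiplicative R d
  (fun r => (cube_count G r)%:R) (c0 + 1) (K + 1).
- lra.
- apply/andP; split.
    rewrite ler1n cardfs_gt0; apply/fset0Pn; exists 0.
    by rewrite in_fset_set// inE; split=> // i; rewrite mxE normr0 ltW.
  apply: le_trans (countG r (ltW r0)).2 _.
  have Kr : 0 <= K * r by rewrite mulr_ge0// ltW.
  have Kc : 0 <= K * c0 by exact: mulr_ge0.
  by rewrite lerXn2r ?nnegrE; nra.
- rewrite -natrX -natrM ler_nat; apply: cube_count_tile denseG _ _ cr nr => //; lra.
- by exists a.
Qed.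

Lemma locally_finite_isom_image Q G : orthogonal_mx Q -> locally_finite G ->
  locally_finite (isom_image Q G).
Proof.
move=> oQ finG r; have [K _ boundQ] := cube_mulmx Q^T.
have QK v : Q^T *m (Q *m v) = v by rewrite mulmxA oQ mul1mx.
apply: (card_fset_set_inj (f := mulmx Q^T) (finG (K * r)) _ _).1.
  by move=> _ [[v Gv <-] /boundQ]; rewrite QK.
by move=> _ _ /set_mem[[v _ <-] _] /set_mem[[w _ <-] _]; rewrite !QK => ->.
Qed.

End Lattices.

(** * Coincidences of packings *)

Section Coincidence.
Context {R : realType} {d : nat}.
Implicit Types (G S : set 'cV[R]_d) (Q : 'M[R]_d) (v w : 'cV[R]_d).

Lemma isom_imageB Q G v w : (forall u v, G u -> G v -> G (u - v)) ->
  isom_image Q G v -> isom_image Q G w -> isom_image Q G (v - w).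
Proof.
by move=> GB [g Gg <-] [h Gh <-]; exists (g - h); [exact: GB | rewrite mulmxBr].
Qed.

Lemma isom_image_mulmx Q S v : orthogonal_mx Q -> isom_image Q S (Q *m v) -> S v.
Proof.
move=> oQ [w Sw /(congr1 (mulmx Q^T))].
by rewrite !mulmxA oQ !mul1mx => <-.
Qed.

Lemma coincidence_set_subgroup Q G :
  G 0 -> (forall u v, G u -> G v -> G (u - v)) ->
  is_subgroup (coincidence_set G Q) G /\
  is_subgroup (coincidence_set G Q) (isom_image Q G).
Proof.
move=> G0 GB; split; split=> [v []//||u v [Gu Qu] [Gv Qv]].
- by split=> //; exists 0; rewrite ?mulmx0.
- by split; [exact: GB | exact: isom_imageB].
- by split=> //; exists 0; rewrite ?mulmx0.
- by split; [exact: GB | exact: isom_imageB].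
Qed.

Context {m : nat}.
Implicit Types (x : 'I_m -> 'cV[R]_d).

Lemma sigmaP G x Q (j k : 'I_m) :
  reflect (exists g h, [/\ G g, G h & Q *m x j - x k = g + Q *m h])
    ((j, k) \in sigma G x Q).
Proof.
rewrite inE; apply: (iffP (asboolP _)) => [[g [_ [Gg [h Gh <-] eqg]]]|[g [h [Gg Gh eqg]]]].
  by exists g, h.
by exists g, (Q *m h); split=> //; exists h.
Qed.

(** With [v = x k + g = Q *m (x j + h)], the offset of [v] from [x k + l j k] is
    [g - l j k], which equals [Q *m (t j k + h)] and so belongs to both groups. *)
Lemma coincidence_set_packing G x Q (l t : 'I_m -> 'I_m -> 'cV[R]_d) :
  is_lattice G ->
  (forall j k, (j, k) \in sigma G x Q ->
    [/\ G (l j k), G (t j k) & Q *m x j - x k = l j k + Q *m t j k]) ->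
  coincidence_set (packing G x) Q =
    \bigcup_(p in [set` sigma G x Q])
      translate (x p.2 + l p.1 p.2) (coincidence_set G Q).
Proof.
move=> /lattice_subgroup[G0 GD GB] ltP; apply/seteqP; split=> v.
  case=> -[k _ [g Gg gv]] [_ [j _ [h Gh <-]] hv].
  have eq_jk : Q *m x j - x k = g - Q *m h.
    by rewrite -[Q *m x j](addrK (Q *m h)) -mulmxDr hv -gv addrAC [x k + g]addrC addrK.
  have jk : (j, k) \in sigma G x Q.
    apply/sigmaP; exists g, (- h); rewrite mulmxN; split=> //.
    by rewrite -sub0r; exact: GB.
  have [Gl Gt eq_lt] := ltP j k jk.
  exists (j, k) => //; apply/translateP => /=.
  have -> : v - (x k + l j k) = g - l j k by rewrite -gv opprD addrA [x k + g]addrC addrK.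
  split; first exact: GB.
  exists (t j k + h); first exact: GD.
  have -> : g = l j k + Q *m t j k + Q *m h by rewrite -eq_lt eq_jk subrK.
  by rewrite mulmxDr [RHS]addrC !addrA addNr add0r.
case=> -[j k] /= jk /translateP[Gv [h Gh hv]]; have [Gl Gt eq_lt] := ltP j k jk.
split.
  exists k => //; apply/translateP.
  by have := GD _ _ Gv Gl; rewrite opprD addrA subrK.
exists (x j + (h - t j k)).
  by exists j => //; exists (h - t j k) => //; exact: GB.
rewrite mulmxDr mulmxBr hv opprD addrA.
rewrite -[Q *m x j](subrK (x k)) eq_lt.
by apply/colP => i; rewrite !mxE; ring.
Qed.

(** The vector [c p] represents both the coset of [x p.2] modulo [G] and that of
    [Q *m x p.1] modulo [Q G]; a common point therefore determines both indices
    of the pair. *)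
Lemma packing_translates_disjoint G x Q (c : 'I_m * 'I_m -> 'cV[R]_d)
    (p q : 'I_m * 'I_m) v :
  is_lattice G -> orthogonal_mx Q ->
  (forall j k : 'I_m, k != j -> ~ G (x k - x j)) ->
  (forall p, p \in sigma G x Q -> G (c p - x p.2) /\ isom_image Q G (c p - Q *m x p.1)) ->
  p \in sigma G x Q -> q \in sigma G x Q ->
  translate (c p) (coincidence_set G Q) v -> translate (c q) (coincidence_set G Q) v ->
  p = q.
Proof.
move=> /lattice_subgroup[G0 GD GB] oQ incong cP sp sq.
move=> /translateP[Gp Qp] /translateP[Gq Qq].
case: p q sp sq Gp Qp Gq Qq => j k [j' k'] /cP[/= Gck Qcj] /cP[/= Gck' Qcj'] Gp Qp Gq Qq.
have eq_k : k = k'.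
  apply/eqP/negPn/negP => /incong; apply.
  have := GB _ _ (GD _ _ Gq Gck') (GD _ _ Gp Gck).
  by congr G; apply/colP => i; rewrite !mxE; ring.
have eq_j : j = j'.
  apply/eqP/negPn/negP => /incong; apply; apply: isom_image_mulmx oQ _.
  have := isom_imageB GB (isom_imageB GB Qq Qp) (isom_imageB GB Qcj Qcj').
  by congr isom_image; rewrite mulmxBr; apply/colP => i; rewrite !mxE; ring.
by rewrite eq_j eq_k.
Qed.

(** The pigeonhole step: the coset [Q *m x j + Q G] reached by [x k + l + h]
    takes finitely many values, and the difference of two [h] with the same [j]
    is a coincidence. *)
Lemma coincidence_isometry_relatively_dense G x Q :
  is_lattice G -> coincidence_isometries G x Q ->
  exists c, relatively_dense (coincidence_set G Q) c.
Proof.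
move=> latG [oQ [k [_ [[l [H [Gl HG fin ->]]] subL]]]].
have [G0 GD GB] := lattice_subgroup latG.
have [c0 _ denseG] := lattice_relatively_dense latG.
have [c denseH] := finite_index_relatively_dense HG fin denseG.
pose piece j h := isom_image Q G (x k + l + h - Q *m x j).
have pieceP h : H h -> exists j, piece j h.
  move=> Hh; have [_ [_ [j _ [g Gg <-]] eq_g]] : coincidence_set (packing G x) Q (x k + l + h).
    by apply: subL; exists h.
  by exists j, g => //; rewrite -eq_g mulmxDr addrC addKr.
have /choice[rep repP] : forall j, exists y, forall h, H h -> piece j h -> H y /\ piece j y.
  move=> j; case: (pselect (exists2 y, H y & piece j y)) => [[y Hy jy]|none].
    by exists y.
  by exists 0 => h Hh jh; case: none; exists h.
exists (c + \sum_j radius (rep j)) => w; have [h Hh wh] := denseH w.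
have [j jh] := pieceP h Hh; have [Hy jy] := repP j h Hh jh.
have [HsubG _ HB] := HG.
exists (h - rep j); last first.
  rewrite opprB addrCA addrC; apply: cubeD => //.
  apply: cube_le (cube_radius _); rewrite (bigD1 j)//= lerDl.
  by apply: sumr_ge0 => ? _; exact: radius_ge0.
split; first by apply/HsubG/HB.
have := isom_imageB GB jh jy; congr isom_image.
by apply/colP => i; rewrite !mxE; ring.
Qed.

Lemma coincidence_isometries_OC G x (k0 : 'I_m) :
  is_lattice G -> x k0 = 0 -> coincidence_isometries G x = OC G.
Proof.
move=> latG xk0; have [G0 GD GB] := lattice_subgroup latG.
have finG := lattice_locally_finite latG.
apply/seteqP; split=> Q.
  move=> iso; have [c dense] := coincidence_isometry_relatively_dense latG iso.
  have [subG subQG] := coincidence_set_subgroup Q G0 GB.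
  have [oQ _] := iso; split=> //; first exact: relatively_dense_finite_index dense.
  apply: relatively_dense_finite_index dense => //.
    exact: locally_finite_isom_image.
  by move=> u v; exact: isom_imageB.
case=> oQ fin _; split=> //.
exists k0, (coincidence_set G Q); split.
  exists 0, (coincidence_set G Q); split=> //.
    by case: (coincidence_set_subgroup Q G0 GB).
  by rewrite xk0 addr0; apply/seteqP; split=> v => [Gv|/translateP];
    [apply/translateP; rewrite subr0 | rewrite subr0].
move=> v [Gv [g Gg gv]]; split; first by exists k0 => //; exists v; rewrite ?xk0 ?add0r.
by exists g => //; exists k0 => //; exists g; rewrite ?xk0 ?add0r.
Qed.

End Coincidence.

Theorem theorem6p3 (R : realType) (d m : nat)
    (G : set 'cV[R]_d) (x : 'I_m -> 'cV[R]_d)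
    (hG : is_lattice G) (hm : (0 < m)%N) (hx0 : x (Ordinal hm) = 0)
    (hx : forall j k : 'I_m, k != j -> ~ G (x k - x j)) :
  coincidence_isometries G x = OC G /\
  (forall Q : 'M[R]_d, OC G Q ->
    is_coincidence_index (packing G x) Q
      (m%:R / #|sigma G x Q|%:R * (Sigma G Q)%:R) /\
    (forall l t : 'I_m -> 'I_m -> 'cV[R]_d,
      (forall j k : 'I_m, (j, k) \in sigma G x Q ->
        [/\ G (l j k), G (t j k) &
            Q *m x j - x k = l j k + Q *m t j k]) ->
      coincidence_set (packing G x) Q =
        \bigcup_(p in [set` sigma G x Q])
          translate (x p.2 + l p.1 p.2) (coincidence_set G Q) /\
      coincidence_set (packing G x) Q =
        \bigcup_(p in [set` sigma G x Q])
          translate (Q *m x p.1 - Q *m t p.1 p.2) (coincidence_set G Q))).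
Proof.
have [G0 GD GB] := lattice_subgroup hG.
split; first exact: coincidence_isometries_OC hx0.
move=> Q [oQ fin _]; split; last first.
  move=> l t ltP; rewrite {1}(coincidence_set_packing hG ltP); split=> //.
  rewrite (coincidence_set_packing hG ltP); apply: eq_bigcupr => -[j k] /= jk.
  have [_ _ eq_lt] := ltP j k jk; congr translate.
  by apply/eqP; rewrite eq_sym subr_eq -addrA -eq_lt addrC subrK.
have [a a_gt0 densG] := lattice_has_density hG.
have [subG _] := coincidence_set_subgroup Q G0 GB.
have densP := finite_index_has_density subG G0 GD fin densG.
have Sigma_gt0 : (0 < Sigma G Q)%N by exact: subgroup_index_gt0.
have sigma_gt0 : (0 < #|sigma G x Q|)%N.
  rewrite card_gt0; apply/set0Pn; exists (Ordinal hm, Ordinal hm); apply/sigmaP.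
  by exists 0, 0; rewrite hx0 mulmx0 subr0 addr0.
have /choice[f fP] : forall p : 'I_m * 'I_m, exists lt : 'cV[R]_d * 'cV[R]_d,
    p \in sigma G x Q -> [/\ G lt.1, G lt.2 & Q *m x p.1 - x p.2 = lt.1 + Q *m lt.2].
  move=> [j k]; have [/sigmaP[g [h gh]]|_] := boolP ((j, k) \in sigma G x Q).
    by exists (g, h).
  by exists (0, 0).
exists (m%:R * a), (#|sigma G x Q|%:R * (a / (Sigma G Q)%:R)); split.
- have := @has_density_bigcup R d 'I_m [set: 'I_m]%SET (fun k => translate (x k) G) a.
  rewrite cardsT card_ord.
  have -> : \bigcup_(k in [set` [set: 'I_m]%SET]) translate (x k) G = packing G x.
    by apply: eq_bigcupl; split=> k //=; rewrite inE.
  apply=> [k _|j k _ _ v /translateP vj /translateP vk]; first exact: has_density_translate.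
  apply/eqP/negPn/negP => /hx; apply; have := GB _ _ vk vj.
  by rewrite opprB addrC addrA subrK.
- rewrite (coincidence_set_packing (l := fun j k => (f (j, k)).1)
    (t := fun j k => (f (j, k)).2) hG (fun j k => fP (j, k))).
  apply: has_density_bigcup => [p _|p q sp sq v]; first exact: has_density_translate.
  apply: (packing_translates_disjoint (c := fun p => x p.2 + (f (p.1, p.2)).1)
    hG oQ hx _ sp sq) => -[j k] /= jk.
  rewrite [x k + _]addrC addrK; have [Gl Gt eq_lt] := fP (j, k) jk; split=> //.
  exists (- (f (j, k)).2); first by rewrite -sub0r; exact: GB.
  have -> : Q *m x j = (f (j, k)).1 + x k + Q *m (f (j, k)).2.
    by rewrite addrAC -eq_lt subrK.
  by rewrite mulmxN opprD addrA subrr add0r.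
- by rewrite mulf_neq0// ?mulf_neq0 ?invr_eq0 ?pnatr_eq0 -?lt0n// gt_eqF.
- by field; rewrite !pnatr_eq0 -!lt0n Sigma_gt0 sigma_gt0 gt_eqF.
Qed.
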